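(* Let $\mathcal{E}$ be an ellipse in the Euclidean plane, let $M$ be a point on $\mathcal{E}$ and let $\theta\in(0,\pi)$. Consider all chords $NL$ of $\mathcal{E}$, with $N,L\in\mathcal{E}\setminus\{M\}$ distinct, such that the triangle $MNL$ has internal angle $\angle NML=\theta$ at $M$. Then there is an ellipse $\mathcal{E}'=\mathcal{E}'_{M,\theta}$ (degenerating to a single point when $\theta=\pi/2$) such that the envelope of the lines $NL$ is included in $\mathcal{E}'$; that is, for $\theta\neq\pi/2$ every such line $NL$ is tangent to the ellipse $\mathcal{E}'$, and for $\theta=\pi/2$ every such line $NL$ passes through the single point $\mathcal{E}'$.
   Context: The envelope of a family of lines is the curve formed by their points of contact with the curve to which all of them are tangent. Only inclusion in $\mathcal{E}'$ is asserted: the envelope need not be the whole of $\mathcal{E}'$. A circle counts as an ellipse. *)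

(* Defs.v *)
(* Stdlib reals with Coquelicot. *)
From Stdlib Require Export Reals.
From Coquelicot Require Export Coquelicot.
Open Scope R_scope.

(* Coquelicot's norm on R * R is the Euclidean one: sqrt (|x|^2 + |y|^2). *)
Definition plane : Type := (R * R)%type.

Definition dot (u v : plane) : R := fst u * fst v + snd u * snd v.

(* [c] is the centre, the orthonormal pair [(u, v)] gives the axes, and [a], [b]
   are the semi-axes; [a = b] (a circle) is allowed. *)
Definition is_ellipse (E : plane -> Prop) : Prop :=
  exists (c u v : plane) (a b : R),
    norm u = 1 /\ norm v = 1 /\ dot u v = 0 /\ 0 < a /\ 0 < b /\
    forall P : plane,
      E P <-> (dot (minus P c) u / a) ^ 2 + (dot (minus P c) v / b) ^ 2 = 1.

Definition line (A B : plane) : plane -> Prop :=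
  fun P => exists t : R, P = plus A (scal t (minus B A)).

Definition angle (A B C : plane) : R :=
  acos (dot (minus A B) (minus C B) / (norm (minus A B) * norm (minus C B))).

(* The line [l] passes through a point [P] of [C] and is directed by the nonzero
   velocity at [P] of a parametrized arc contained in [C]. This is meant for
   sets [C] that are regular curves, where it gives the usual tangent line. *)
Definition tangent (C l : plane -> Prop) : Prop :=
  exists (P w : plane) (g : R -> plane),
    C P /\ g 0 = P /\ locally 0 (fun t => C (g t)) /\
    is_derive g 0 w /\ w <> zero /\
    (forall Q : plane, l Q <-> exists t : R, Q = plus P (scal t w)).

Definition is_chord_with_angle (E : plane -> Prop) (M : plane) (theta : R)
    (N L : plane) : Prop :=
  E N /\ E L /\ N <> M /\ L <> M /\ N <> L /\ angle N M L = theta.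

(* Main.v *)
Require Import Defs.
From Stdlib Require Import Lra.

(** Take orthonormal coordinates at [M] whose first axis is tangent to [E], so
    that [E] is the conic [Q x y = y] with [Q x y = A x^2 + 2 B x y + C y^2]
    positive definite, and put [l x y = 1 + (A - C) y - 2 B x]. The curve [E']
    is [(sin theta)^2 l^2 + 4 A (Q - y) = 0].
    Let [l1], [l2] be the values of [l] at [N], [L]; on [E] one has
    [l = A (x^2 + y^2) / y > 0]. On the chord [(1 - t) N + t L] the
    polynomial [Q - y] is [- t (1 - t) Q (L - N)], and the angle condition
    says exactly that [A Q (L - N) = (sin theta)^2 l1 l2]; hence the equation of
    [E'] restricts to [(sin theta)^2 ((1 - t) l1 - t l2)^2], which has the
    single double root [t = l1 / (l1 + l2)]. The equation of [E'] can also be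
    written [((A + C) y + 2 B x - 1)^2 + 4 A^2 x^2 = (cos theta)^2 l^2], which
    reduces to the point [(0, 1 / (A + C))] when [theta = PI / 2]. *)

(** * Coordinates in a rotated orthonormal frame *)

(** When [p ^ 2 + q ^ 2 = 1], the pair [(p, q)] encodes a direct orthonormal frame at [O], with axes
    [(p, q)] and [(- q, p)]. *)
Definition xcoord (O : plane) (p q : R) (P : plane) : R :=
  (fst P - fst O) * p + (snd P - snd O) * q.

Definition ycoord (O : plane) (p q : R) (P : plane) : R :=
  (snd P - snd O) * p - (fst P - fst O) * q.

Lemma plane_sub (A B : plane) : minus A B = (fst A - fst B, snd A - snd B).
Proof. reflexivity. Qed.

Lemma plane_add (A B : plane) : plus A B = (fst A + fst B, snd A + snd B).
Proof. reflexivity. Qed.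

Lemma plane_scal (t : R) (A : plane) : scal t A = (t * fst A, t * snd A).
Proof. reflexivity. Qed.

Lemma norm_dot (u : plane) : norm u = sqrt (dot u u).
Proof.
  unfold norm, dot; simpl; unfold prod_norm, norm; simpl; unfold abs; simpl.
  f_equal. rewrite !Rmult_1_r, <- !Rabs_mult, !Rabs_pos_eq; nra.
Qed.

Lemma norm_1_dot (u : plane) : norm u = 1 -> dot u u = 1.
Proof.
  rewrite norm_dot; intros H.
  rewrite <- (sqrt_sqrt (dot u u)), H; [ring | unfold dot; nra].
Qed.

Lemma dot_1_norm (u : plane) : dot u u = 1 -> norm u = 1.
Proof. intros H; rewrite norm_dot, H; apply sqrt_1. Qed.

Lemma xcoord_segment (O : plane) (p q : R) (A B : plane) (t : R) :
  xcoord O p q (plus A (scal t (minus B A)))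
  = (1 - t) * xcoord O p q A + t * xcoord O p q B.
Proof. rewrite plane_sub, plane_scal, plane_add; unfold xcoord; simpl; ring. Qed.

Lemma ycoord_segment (O : plane) (p q : R) (A B : plane) (t : R) :
  ycoord O p q (plus A (scal t (minus B A)))
  = (1 - t) * ycoord O p q A + t * ycoord O p q B.
Proof. rewrite plane_sub, plane_scal, plane_add; unfold ycoord; simpl; ring. Qed.

Lemma coord_inj (O : plane) (p q : R) (P P' : plane) :
  p ^ 2 + q ^ 2 = 1 ->
  xcoord O p q P = xcoord O p q P' -> ycoord O p q P = ycoord O p q P' -> P = P'.
Proof.
  intros Hpq; destruct O as [o1 o2], P as [x y], P' as [x' y'].
  unfold xcoord, ycoord; cbn [fst snd]; intros Hx Hy.
  f_equal; apply Rminus_diag_uniq.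
  - transitivity ((x - x') * (p ^ 2 + q ^ 2)); [rewrite Hpq; ring |].
    transitivity
      (((x - o1) * p + (y - o2) * q - ((x' - o1) * p + (y' - o2) * q)) * p
       - ((y - o2) * p - (x - o1) * q - ((y' - o2) * p - (x' - o1) * q)) * q);
      [ring | rewrite Hx, Hy; ring].
  - transitivity ((y - y') * (p ^ 2 + q ^ 2)); [rewrite Hpq; ring |].
    transitivity
      (((x - o1) * p + (y - o2) * q - ((x' - o1) * p + (y' - o2) * q)) * q
       + ((y - o2) * p - (x - o1) * q - ((y' - o2) * p - (x' - o1) * q)) * p);
      [ring | rewrite Hx, Hy; ring].
Qed.

Lemma coord_surj (O : plane) (p q x y : R) :
  p ^ 2 + q ^ 2 = 1 ->
  exists P : plane, xcoord O p q P = x /\ ycoord O p q P = y.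
Proof.
  intros Hpq; exists (fst O + x * p - y * q, snd O + x * q + y * p).
  unfold xcoord, ycoord; cbn [fst snd]; split.
  - transitivity (x * (p ^ 2 + q ^ 2)); [ring | rewrite Hpq; ring].
  - transitivity (y * (p ^ 2 + q ^ 2)); [ring | rewrite Hpq; ring].
Qed.

Lemma coord_origin (O : plane) (p q : R) : xcoord O p q O = 0 /\ ycoord O p q O = 0.
Proof. unfold xcoord, ycoord; split; ring. Qed.

Lemma dot_coord (O : plane) (p q : R) (P P' : plane) :
  p ^ 2 + q ^ 2 = 1 ->
  dot (minus P O) (minus P' O)
  = xcoord O p q P * xcoord O p q P' + ycoord O p q P * ycoord O p q P'.
Proof.
  intros Hpq; rewrite !plane_sub; unfold dot, xcoord, ycoord; cbn [fst snd].
  match goal with |- ?l = _ => transitivity (l * (p ^ 2 + q ^ 2)) end.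
  - rewrite Hpq; ring.
  - ring.
Qed.

(** * Ellipses as positive definite conics *)

(** A unit vector orthogonal to [(p, q)] is [(- q, p)] up to sign, and the sign disappears in the
    square; so one unit vector encodes both axes. *)
Lemma is_ellipse_coord (E : plane -> Prop) :
  is_ellipse E <->
  exists (c : plane) (p q a b : R),
    p ^ 2 + q ^ 2 = 1 /\ 0 < a /\ 0 < b /\
    forall P, E P <-> (xcoord c p q P / a) ^ 2 + (ycoord c p q P / b) ^ 2 = 1.
Proof.
  split.
  - intros (c & [u1 u2] & [v1 v2] & a & b & Hu & Hv & Huv & Ha & Hb & HE).
    apply norm_1_dot in Hu; apply norm_1_dot in Hv.
    unfold dot in Hu, Hv, Huv; simpl in Hu, Hv, Huv.
    exists c, u1, u2, a, b.
    split; [lra | split; [exact Ha | split; [exact Hb |]]].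
    intros P; rewrite HE, plane_sub; unfold dot, xcoord, ycoord; cbn [fst snd].
    (* The determinant of the frame, 1 or -1 according to its orientation. *)
    set (e := u1 * v2 - u2 * v1).
    assert (H1 : v1 = - e * u2).
    { transitivity (v1 * (u1 * u1 + u2 * u2) - u1 * (u1 * v1 + u2 * v2));
        [rewrite Hu, Huv; ring | unfold e; ring]. }
    assert (H2 : v2 = e * u1).
    { transitivity (v2 * (u1 * u1 + u2 * u2) - u2 * (u1 * v1 + u2 * v2));
        [rewrite Hu, Huv; ring | unfold e; ring]. }
    clearbody e; subst v1 v2.
    assert (He : e * e = 1)
      by (transitivity (e * e * (u1 * u1 + u2 * u2)); [rewrite Hu; ring | lra]).
    set (d1 := fst P - fst c); set (d2 := snd P - snd c).
    replace ((d1 * (- e * u2) + d2 * (e * u1)) / b) with (e * ((d2 * u1 - d1 * u2) / b))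
      by (field; lra).
    replace ((e * ((d2 * u1 - d1 * u2) / b)) ^ 2)
      with (e * e * ((d2 * u1 - d1 * u2) / b) ^ 2) by ring.
    rewrite He, Rmult_1_l; reflexivity.
  - intros (c & p & q & a & b & Hpq & Ha & Hb & HE).
    exists c, (p, q), (- q, p), a, b.
    split; [apply dot_1_norm; unfold dot; simpl; lra |].
    split; [apply dot_1_norm; unfold dot; simpl; lra |].
    split; [unfold dot; simpl; ring |].
    split; [exact Ha | split; [exact Hb |]].
    intros P; rewrite HE, plane_sub; unfold dot, xcoord, ycoord; cbn [fst snd].
    replace ((fst P - fst c) * - q + (snd P - snd c) * p)
      with ((snd P - snd c) * p - (fst P - fst c) * q) by ring.
    reflexivity.
Qed.

(** The second equation makes [(h, k)] an eigenvector of the symmetric matrix with rows [(al, be)]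
    and [(be, ga)]; rotating the first axis onto it removes the cross term of the quadratic form. *)
Lemma diagonalizing_rotation (al be ga : R) :
  exists h k : R, h ^ 2 + k ^ 2 = 1 /\ be * (h ^ 2 - k ^ 2) + (ga - al) * h * k = 0.
Proof.
  destruct (Req_dec be 0) as [-> | Hbe].
  - exists 1, 0; split; ring.
  (* [(2 * be, z)] is an eigenvector for the eigenvalue [(al + ga + r) / 2], nonzero because [be]
     is; [n] is its norm. *)
  - set (r := sqrt ((ga - al) ^ 2 + 4 * be ^ 2)).
    assert (Hr : r * r = (ga - al) ^ 2 + 4 * be ^ 2)
      by (apply sqrt_sqrt; pose proof (pow2_ge_0 (ga - al)); pose proof (pow2_ge_0 be); lra).
    set (z := ga - al + r).
    set (n := sqrt (4 * be ^ 2 + z ^ 2)).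
    assert (Hpos : 0 < 4 * be ^ 2 + z ^ 2)
      by (assert (0 < be ^ 2) by (rewrite <- Rsqr_pow2; apply Rsqr_pos_lt, Hbe);
          pose proof (pow2_ge_0 z); lra).
    assert (Hn : n * n = 4 * be ^ 2 + z ^ 2) by (apply sqrt_sqrt; lra).
    assert (0 < n) by (apply sqrt_lt_R0; lra).
    exists (2 * be / n), (z / n); split.
    + transitivity ((4 * be ^ 2 + z ^ 2) / (n * n)); [field; lra | rewrite Hn; field; lra].
    + transitivity (be * (4 * be ^ 2 + (ga - al) ^ 2 - r * r) / (n * n));
        [unfold z; field; lra | rewrite Hr; unfold Rdiv; ring].
Qed.

(** Translate to the centre, then rotate to the principal axes. The negative value at [(x1, y1)]
    excludes an empty locus and a single point. *)
Lemma conic_is_ellipse (O : plane) (p q al be ga de ep ze x1 y1 : R) :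
  p ^ 2 + q ^ 2 = 1 -> 0 < al -> be ^ 2 < al * ga ->
  al * x1 ^ 2 + 2 * be * x1 * y1 + ga * y1 ^ 2 + 2 * de * x1 + 2 * ep * y1 + ze < 0 ->
  is_ellipse (fun P =>
    let x := xcoord O p q P in let y := ycoord O p q P in
    al * x ^ 2 + 2 * be * x * y + ga * y ^ 2 + 2 * de * x + 2 * ep * y + ze = 0).
Proof.
  intros Hpq Hal Hdisc Hneg.
  apply is_ellipse_coord.
  set (D := al * ga - be ^ 2).
  assert (HD : 0 < D) by (unfold D; lra).
  (* The centre [(x0, y0)] is where the gradient vanishes, by Cramer's rule; the polynomial takes
     its minimum [- K] there. *)
  set (x0 := (be * ep - ga * de) / D).
  set (y0 := (be * de - al * ep) / D).
  set (K := - (ze + de * x0 + ep * y0)).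
  assert (Hcx : al * x0 + be * y0 = - de) by (unfold x0, y0, D; field; lra).
  assert (Hcy : be * x0 + ga * y0 = - ep) by (unfold x0, y0, D; field; lra).
  assert (Hshift : forall x y,
    al * x ^ 2 + 2 * be * x * y + ga * y ^ 2 + 2 * de * x + 2 * ep * y + ze
    = al * (x - x0) ^ 2 + 2 * be * (x - x0) * (y - y0) + ga * (y - y0) ^ 2 - K).
  { intros x y; unfold K.
    replace de with (- (al * x0 + be * y0)) by lra.
    replace ep with (- (be * x0 + ga * y0)) by lra. ring. }
  clearbody x0 y0 K.
  assert (HK : 0 < K).
  { rewrite Hshift in Hneg.
    set (x := x1 - x0) in *; set (y := y1 - y0) in *.
    assert (al * (al * x ^ 2 + 2 * be * x * y + ga * y ^ 2)
            = (al * x + be * y) ^ 2 + D * y ^ 2) by (unfold D; ring).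
    assert (0 <= (al * x + be * y) ^ 2 + D * y ^ 2)
      by (apply Rplus_le_le_0_compat; [apply pow2_ge_0 |
          apply Rmult_le_pos; [lra | apply pow2_ge_0]]).
    nra. }
  destruct (diagonalizing_rotation al be ga) as (h & k & Hhk & Hdiag).
  set (l := al * h ^ 2 + 2 * be * h * k + ga * k ^ 2).
  set (m := al * k ^ 2 - 2 * be * h * k + ga * h ^ 2).
  assert (Hrot : forall x y, al * x ^ 2 + 2 * be * x * y + ga * y ^ 2
                   = l * (x * h + y * k) ^ 2 + m * (y * h - x * k) ^ 2).
  { intros x y.
    transitivity ((al * x ^ 2 + 2 * be * x * y + ga * y ^ 2) * (h ^ 2 + k ^ 2) ^ 2);
      [rewrite Hhk; ring |].
    transitivity (l * (x * h + y * k) ^ 2 + m * (y * h - x * k) ^ 2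
       + 2 * (be * (h ^ 2 - k ^ 2) + (ga - al) * h * k)
           * (x * h + y * k) * (y * h - x * k));
      [unfold l, m; ring | rewrite Hdiag; ring]. }
  assert (Hprod : l * m = D).
  { transitivity (D * (h ^ 2 + k ^ 2) ^ 2
                  + (be * (h ^ 2 - k ^ 2) + (ga - al) * h * k) ^ 2);
      [unfold l, m, D; ring | rewrite Hdiag, Hhk; ring]. }
  assert (Hsum : l + m = al + ga).
  { transitivity ((al + ga) * (h ^ 2 + k ^ 2)); [unfold l, m; ring | rewrite Hhk; ring]. }
  (* The diagonal coefficients [l] and [m] have product [D > 0] and sum [al + ga > 0], so both are
     positive. *)
  assert (0 < ga) by nra.
  assert (Hl : 0 < l) by nra.
  assert (Hm : 0 < m) by nra.
  clearbody l m.
  destruct (coord_surj O p q x0 y0 Hpq) as (c & Hc1 & Hc2).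
  exists c, (h * p - k * q), (h * q + k * p), (sqrt (K / l)), (sqrt (K / m)).
  assert (0 < K / l) by (apply Rdiv_lt_0_compat; lra).
  assert (0 < K / m) by (apply Rdiv_lt_0_compat; lra).
  split; [transitivity ((p ^ 2 + q ^ 2) * (h ^ 2 + k ^ 2));
          [ring | rewrite Hpq, Hhk; ring] |].
  split; [apply sqrt_lt_R0; assumption |].
  split; [apply sqrt_lt_R0; assumption |].
  intros P; split.
  all: cbv zeta; rewrite Hshift, Hrot, <- Hc1, <- Hc2.
  all: unfold Rdiv; rewrite !Rpow_mult_distr, !pow_inv, !pow2_sqrt by lra.
  all: unfold xcoord, ycoord; intros HP.
  - match type of HP with l * ?X + m * ?Y - K = 0 =>
      transitivity ((l * X + m * Y) / K) end.
    + field; lra.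
    + replace (_ + _) with K by lra. field; lra.
  - match type of HP with ?l = _ =>
      match goal with |- ?g = 0 => replace g with (K * (l - 1)) end end.
    + rewrite HP; ring.
    + field; lra.
Qed.

(** * Tangent lines to an ellipse *)

Lemma is_derive_scal_plane (f : R -> R) (x l : R) (u : plane) :
  is_derive f x l -> is_derive (fun t => scal (f t) u : plane) x (scal l u).
Proof.
  exact (@is_derive_scal_l R_AbsRing
           (prod_NormedModule R_AbsRing R_NormedModule R_NormedModule) f x l u).
Qed.

(** An affine change of coordinates turns [E] into the unit circle. A line meeting the circle once
    is orthogonal to the radius there, hence is directed by the velocity of a uniform rotation. *)
Lemma tangent_if_touching_once (E l : plane -> Prop) (P w : plane) :
  is_ellipse E -> E P -> w <> zero ->
  (forall Q, l Q <-> exists t : R, Q = plus P (scal t w)) ->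
  (forall t, E (plus P (scal t w)) -> t = 0) ->
  tangent E l.
Proof.
  intros HE HP Hw Hl Honce.
  apply is_ellipse_coord in HE.
  destruct HE as (c & p & q & a & b & Hpq & Ha & Hb & HE).
  (* [(e, f)] and [(o1, o2)] represent [P] and [w] in the coordinates where [E] is the unit
     circle. *)
  set (e := xcoord c p q P / a); set (f := ycoord c p q P / b).
  set (o1 := (fst w * p + snd w * q) / a).
  set (o2 := (snd w * p - fst w * q) / b).
  assert (Hef : e ^ 2 + f ^ 2 = 1) by (apply HE, HP).
  assert (Hline : forall t, E (plus P (scal t w)) <->
                            (e + t * o1) ^ 2 + (f + t * o2) ^ 2 = 1).
  { intros t; rewrite HE, plane_scal, plane_add.
    unfold e, f, o1, o2, xcoord, ycoord; cbn [fst snd].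
    match goal with |- ?x = 1 <-> ?y = 1 => replace x with y; [tauto | field; lra] end. }
  assert (Hw1 : fst w = a * o1 * p - b * o2 * q).
  { transitivity (fst w * (p ^ 2 + q ^ 2)); [rewrite Hpq; ring | unfold o1, o2; field; lra]. }
  assert (Hw2 : snd w = a * o1 * q + b * o2 * p).
  { transitivity (snd w * (p ^ 2 + q ^ 2)); [rewrite Hpq; ring | unfold o1, o2; field; lra]. }
  assert (HW : 0 < o1 ^ 2 + o2 ^ 2).
  { destruct (Req_dec (o1 ^ 2 + o2 ^ 2) 0) as [H0 | H0]; [| nra].
    exfalso; apply Hw.
    assert (H1 : o1 = 0) by nra. assert (H2 : o2 = 0) by nra.
    rewrite H1, H2 in Hw1, Hw2. destruct w as [w1 w2]; simpl in Hw1, Hw2.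
    rewrite Hw1, Hw2. unfold zero; simpl; unfold prod_zero, zero; simpl; f_equal; ring. }
  (* The line meets [E] again at the second root of the quadratic, unless [w] is
     orthogonal to the gradient. *)
  assert (HG : e * o1 + f * o2 = 0).
  { set (G := e * o1 + f * o2) in *; set (W := o1 ^ 2 + o2 ^ 2) in *.
    assert (Ht : - 2 * G / W = 0).
    { apply Honce, Hline.
      transitivity (e ^ 2 + f ^ 2 + 2 * (- 2 * G / W) * G + (- 2 * G / W) ^ 2 * W);
        [unfold G, W; ring | rewrite Hef; field; lra]. }
    replace G with (- (- 2 * G / W) * W / 2) by (field; lra).
    rewrite Ht; field. }
  (* Being orthogonal to the unit vector [(e, f)], the vector [(o1, o2)] is [k] times [(- f, e)]. *)
  set (k := e * o2 - f * o1).
  assert (Hk1 : o1 = - k * f).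
  { transitivity (o1 * (e ^ 2 + f ^ 2) - e * (e * o1 + f * o2));
      [rewrite Hef, HG; ring | unfold k; ring]. }
  assert (Hk2 : o2 = k * e).
  { transitivity (o2 * (e ^ 2 + f ^ 2) - f * (e * o1 + f * o2));
      [rewrite Hef, HG; ring | unfold k; ring]. }
  (* The arc is the image of the rotation of [(e, f)] at angular speed [k], which makes its velocity
     at 0 equal to [w]. *)
  exists P, w, (fun t => plus c
    (plus (scal (a * (e * cos (k * t) - f * sin (k * t))) ((p, q) : plane))
          (scal (b * (f * cos (k * t) + e * sin (k * t))) ((- q, p) : plane)))).
  split; [assumption |]; split; [| split; [| split; [| split; assumption]]].
  - rewrite Rmult_0_r, cos_0, sin_0.
    rewrite !plane_scal, !plane_add.
    apply (coord_inj c p q); try assumption; unfold xcoord, ycoord; cbn [fst snd].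
    + transitivity (a * e * (p ^ 2 + q ^ 2)); [ring |].
      rewrite Hpq; unfold e, xcoord; field; lra.
    + transitivity (b * f * (p ^ 2 + q ^ 2)); [ring |].
      rewrite Hpq; unfold f, ycoord; field; lra.
  - apply filter_forall; intros t; apply HE.
    rewrite !plane_scal, !plane_add; unfold xcoord, ycoord; cbn [fst snd].
    set (C := cos (k * t)); set (S := sin (k * t)).
    assert (HCS : C ^ 2 + S ^ 2 = 1)
      by (rewrite Rplus_comm, <- !Rsqr_pow2; apply sin2_cos2).
    transitivity ((p ^ 2 + q ^ 2) ^ 2 * (e ^ 2 + f ^ 2) * (C ^ 2 + S ^ 2));
      [field; lra | rewrite Hpq, Hef, HCS; ring].
  - replace w with (plus (zero : plane)
      (plus (scal (- a * k * f) ((p, q) : plane)) (scal (b * k * e) ((- q, p) : plane)))).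
    + apply @is_derive_plus; [apply @is_derive_const |].
      apply @is_derive_plus.
      * apply (is_derive_scal_plane (fun t => a * (e * cos (k * t) - f * sin (k * t)))).
        auto_derive; [easy |]. rewrite Rmult_0_r, cos_0, sin_0; ring.
      * apply (is_derive_scal_plane (fun t => b * (f * cos (k * t) + e * sin (k * t)))).
        auto_derive; [easy |]. rewrite Rmult_0_r, cos_0, sin_0; ring.
    + rewrite plus_zero_l, !plane_scal, plane_add; cbn [fst snd].
      rewrite (surjective_pairing w), Hw1, Hw2, Hk1, Hk2; f_equal; ring.
Qed.

(** * The equation of the ellipse in a frame at [M] *)

(** The origin at [M] removes the constant term, a second axis along the inward normal removes the
    linear term in the first coordinate, and dividing by the norm of the gradient normalizes the
    other one. *)
Lemma tangent_frame (E : plane -> Prop) (M : plane) :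
  is_ellipse E -> E M ->
  exists p q A B C : R,
    p ^ 2 + q ^ 2 = 1 /\ 0 < A /\ B ^ 2 < A * C /\
    forall P, E P <->
      A * xcoord M p q P ^ 2 + 2 * B * xcoord M p q P * ycoord M p q P
      + C * ycoord M p q P ^ 2 = ycoord M p q P.
Proof.
  intros HE HM; apply is_ellipse_coord in HE.
  destruct HE as (c & p & q & a & b & Hpq & Ha & Hb & HE).
  set (i := / a); set (j := / b).
  assert (Hi : 0 < i) by (apply Rinv_0_lt_compat, Ha).
  assert (Hj : 0 < j) by (apply Rinv_0_lt_compat, Hb).
  set (m := xcoord c p q M); set (n := ycoord c p q M).
  assert (Hmn : m ^ 2 * i ^ 2 + n ^ 2 * j ^ 2 = 1).
  { apply HE in HM; fold m n in HM. unfold Rdiv in HM; fold i j in HM. nra. }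
  (* Half the gradient at [M] of the equation of [E]; it is nonzero since its product with [(m, n)]
     is 1. *)
  set (gx := m * i ^ 2); set (gy := n * j ^ 2).
  set (r := sqrt (gx ^ 2 + gy ^ 2)).
  assert (Hg : 0 < gx ^ 2 + gy ^ 2).
  { destruct (Req_dec (gx ^ 2 + gy ^ 2) 0) as [H0 | H0]; [| nra].
    assert (H1 : gx = 0) by nra. assert (H2 : gy = 0) by nra.
    assert (m * gx + n * gy = 1) by (rewrite <- Hmn; unfold gx, gy; ring).
    rewrite H1, H2 in *; lra. }
  assert (Hr : 0 < r) by (apply sqrt_lt_R0, Hg).
  assert (Hrr : r * r = gx ^ 2 + gy ^ 2) by (apply sqrt_sqrt; lra).
  (* [(h, k)] is the unit tangent at [M], and [(- k, h)] the inward unit normal. *)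
  set (h := - gy / r); set (k := gx / r).
  assert (Hhk : h ^ 2 + k ^ 2 = 1).
  { transitivity ((gx ^ 2 + gy ^ 2) / (r * r)); [unfold h, k; field; lra |].
    rewrite Hrr; field; lra. }
  assert (Hgr : gx = k * r /\ gy = - h * r) by (unfold h, k; split; field; lra).
  destruct Hgr as [Hgx Hgy]; clearbody h k r.
  exists (h * p - k * q), (h * q + k * p),
    ((h ^ 2 * i ^ 2 + k ^ 2 * j ^ 2) / (2 * r)),
    (h * k * (j ^ 2 - i ^ 2) / (2 * r)),
    ((k ^ 2 * i ^ 2 + h ^ 2 * j ^ 2) / (2 * r)).
  assert (Hi2 : 0 < i ^ 2) by (apply pow_lt, Hi).
  assert (Hj2 : 0 < j ^ 2) by (apply pow_lt, Hj).
  split; [| split; [| split]].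
  - transitivity ((p ^ 2 + q ^ 2) * (h ^ 2 + k ^ 2)); [ring | rewrite Hpq, Hhk; ring].
  - apply Rdiv_lt_0_compat; [| lra].
    destruct (Req_dec h 0) as [-> | Hh].
    + replace (k ^ 2) with 1 by lra; lra.
    + assert (0 < h ^ 2) by (rewrite <- Rsqr_pow2; apply Rsqr_pos_lt, Hh).
      pose proof (pow2_ge_0 k); nra.
  (* The determinant of a quadratic form is invariant under rotation. *)
  - apply Rlt_0_minus.
    match goal with |- 0 < ?x =>
      replace x with (i ^ 2 * j ^ 2 * (h ^ 2 + k ^ 2) ^ 2 / (4 * (r * r))) end.
    + rewrite Hhk; apply Rdiv_lt_0_compat; [| nra].
      apply Rmult_lt_0_compat; [apply Rmult_lt_0_compat; assumption | lra].
    + field; lra.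
  - intros P; rewrite HE; unfold Rdiv at 1 2; fold i j.
    set (x := xcoord M _ _ P); set (y := ycoord M _ _ P).
    assert (Hx : xcoord c p q P = m + x * h - y * k).
    { transitivity (m + (xcoord c p q P - m) * (h ^ 2 + k ^ 2)); [rewrite Hhk; ring |].
      unfold m, x, y, xcoord, ycoord; ring. }
    assert (Hy : ycoord c p q P = n + x * k + y * h).
    { transitivity (n + (ycoord c p q P - n) * (h ^ 2 + k ^ 2)); [rewrite Hhk; ring |].
      unfold n, x, y, xcoord, ycoord; ring. }
    rewrite Hx, Hy; clearbody x y.
    assert (Hexp : ((m + x * h - y * k) * i) ^ 2 + ((n + x * k + y * h) * j) ^ 2 - 1
      = 2 * r * ((h ^ 2 * i ^ 2 + k ^ 2 * j ^ 2) / (2 * r) * x ^ 2 +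
         2 * (h * k * (j ^ 2 - i ^ 2) / (2 * r)) * x * y +
         (k ^ 2 * i ^ 2 + h ^ 2 * j ^ 2) / (2 * r) * y ^ 2 - y)).
    { transitivity ((m ^ 2 * i ^ 2 + n ^ 2 * j ^ 2 - 1)
        + 2 * (gx * (x * h - y * k) + gy * (x * k + y * h))
        + (x * h - y * k) ^ 2 * i ^ 2 + (x * k + y * h) ^ 2 * j ^ 2);
        [unfold gx, gy; ring |].
      rewrite Hgx, Hgy, Hmn.
      transitivity (- 2 * r * y * (h ^ 2 + k ^ 2)
        + (x * h - y * k) ^ 2 * i ^ 2 + (x * k + y * h) ^ 2 * j ^ 2); [ring |].
      rewrite Hhk; field; lra. }
    split; intros H.
    + rewrite H in Hexp. nra.
    + rewrite H in Hexp. lra.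
Qed.

(** * The angle condition without square roots *)

(** By Lagrange's identity, the two sides differ by the square of the determinant. *)
Lemma dot_cauchy_schwarz (u v : plane) : dot u v ^ 2 <= dot u u * dot v v.
Proof.
  destruct u as [u1 u2], v as [v1 v2]; unfold dot; cbn [fst snd].
  pose proof (pow2_ge_0 (u1 * v2 - u2 * v1)); lra.
Qed.

(** Distinctness makes the norms nonzero, and Cauchy-Schwarz puts the quotient in [-1, 1], where
    [cos] inverts [acos]. *)
Lemma cos_angle_sqr (A B C : plane) :
  A <> B -> C <> B ->
  dot (minus A B) (minus C B) ^ 2
  = cos (angle A B C) ^ 2
    * (dot (minus A B) (minus A B) * dot (minus C B) (minus C B)).
Proof.
  assert (Hpos : forall X Y : plane, X <> Y -> 0 < dot (minus X Y) (minus X Y)).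
  { intros [x1 x2] [y1 y2] H; unfold dot; rewrite plane_sub; simpl.
    assert (H0 : x1 - y1 <> 0 \/ x2 - y2 <> 0).
    { destruct (Req_dec x1 y1) as [-> | ?]; [| left; lra].
      right; intros H0; apply H; f_equal; lra. }
    pose proof (Rle_0_sqr (x1 - y1)); pose proof (Rle_0_sqr (x2 - y2)).
    destruct H0 as [H0 | H0]; apply Rsqr_pos_lt in H0; unfold Rsqr in *; lra. }
  intros HA%Hpos HC%Hpos; unfold angle; rewrite !norm_dot.
  set (u := minus A B) in *; set (v := minus C B) in *.
  set (n := sqrt (dot u u) * sqrt (dot v v)).
  assert (Hn : 0 < n) by (apply Rmult_lt_0_compat; apply sqrt_lt_R0; assumption).
  assert (Hnn : n ^ 2 = dot u u * dot v v).
  { unfold n; rewrite Rpow_mult_distr, !pow2_sqrt; lra. }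
  assert (Hcs : dot u v ^ 2 <= n ^ 2) by (rewrite Hnn; apply dot_cauchy_schwarz).
  rewrite cos_acos, <- Hnn.
  - field; lra.
  - assert (- n <= dot u v <= n).
    { rewrite <- !Rsqr_pow2 in Hcs; apply Rsqr_le_abs_0 in Hcs.
      rewrite (Rabs_pos_eq n) in Hcs by lra; apply Rabs_le_between, Hcs. }
    split; [apply Rle_div_r | apply Rle_div_l]; lra.
Qed.

(** * The curve [E'] and its restriction to a chord *)

Definition quad (A B C x y : R) : R := A * x ^ 2 + 2 * B * x * y + C * y ^ 2.

(** Its zero set is the polar, with respect to the conic [quad = y], of the point
    [(0, 1 / (A + C))]. *)
Definition ell (A B C x y : R) : R := 1 + (A - C) * y - 2 * B * x.

Lemma quad_nonneg (A B C x y : R) :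
  0 < A -> B ^ 2 < A * C -> 0 <= quad A B C x y.
Proof.
  intros HA Hdisc.
  assert (A * quad A B C x y = (A * x + B * y) ^ 2 + (A * C - B ^ 2) * y ^ 2)
    by (unfold quad; ring).
  pose proof (pow2_ge_0 (A * x + B * y)).
  assert (0 <= (A * C - B ^ 2) * y ^ 2)
    by (apply Rmult_le_pos; [lra | apply pow2_ge_0]).
  nra.
Qed.

(** The conic lies on one side of its tangent at the origin, since [y] equals a positive definite
    form; the conic equation also eliminates [B] and [C] from [ell * y]. *)
Lemma conic_point_pos (A B C x y : R) :
  0 < A -> B ^ 2 < A * C ->
  quad A B C x y = y -> ~ (x = 0 /\ y = 0) ->
  0 < y /\ ell A B C x y * y = A * (x ^ 2 + y ^ 2) /\ 0 < ell A B C x y.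
Proof.
  intros HA Hdisc HQ Hne.
  assert (Hy : 0 < y).
  { destruct (Req_dec y 0) as [Hy | Hy].
    - exfalso; apply Hne; split; [| exact Hy].
      assert (Hx : A * (x * x) = 0)
        by (rewrite Hy in HQ; rewrite <- HQ; unfold quad; ring).
      apply Rmult_integral in Hx; destruct Hx as [Hx | Hx]; [lra |].
      apply Rmult_integral in Hx; tauto.
    - pose proof (quad_nonneg A B C x y HA Hdisc); lra. }
  assert (Hell : ell A B C x y * y = A * (x ^ 2 + y ^ 2)).
  { transitivity (y - quad A B C x y + A * (x ^ 2 + y ^ 2));
      [unfold ell, quad; ring | lra]. }
  repeat split; try assumption.
  assert (0 < A * (x ^ 2 + y ^ 2)) by
    (pose proof (pow2_ge_0 x); pose proof (pow_lt y 2 Hy); apply Rmult_lt_0_compat; lra).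
  apply (Rmult_lt_reg_r y); lra.
Qed.

Lemma envelope_on_chord (A B C s2 x1 y1 x2 y2 t : R) :
  0 < A -> B ^ 2 < A * C ->
  quad A B C x1 y1 = y1 -> ~ (x1 = 0 /\ y1 = 0) ->
  quad A B C x2 y2 = y2 -> ~ (x2 = 0 /\ y2 = 0) ->
  (x1 * y2 - x2 * y1) ^ 2 = s2 * ((x1 ^ 2 + y1 ^ 2) * (x2 ^ 2 + y2 ^ 2)) ->
  let x := (1 - t) * x1 + t * x2 in
  let y := (1 - t) * y1 + t * y2 in
  s2 * ell A B C x y ^ 2 + 4 * A * (quad A B C x y - y)
  = s2 * ((1 - t) * ell A B C x1 y1 - t * ell A B C x2 y2) ^ 2.
Proof.
  intros HA Hdisc H1 N1 H2 N2 Hang x y.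
  destruct (conic_point_pos A B C x1 y1 HA Hdisc H1 N1) as (Hy1 & Hl1 & _).
  destruct (conic_point_pos A B C x2 y2 HA Hdisc H2 N2) as (Hy2 & Hl2 & _).
  (* After multiplication by [y1 * y2], both sides equal [A ^ 2] times the squared determinant: the
     left one by a combination of the two conic equations, the right one by the angle condition. *)
  assert (Hkey : A * quad A B C (x2 - x1) (y2 - y1)
                 = s2 * (ell A B C x1 y1 * ell A B C x2 y2)).
  { apply (Rmult_eq_reg_r (y1 * y2)); [| nra].
    transitivity (A ^ 2 * (x1 * y2 - x2 * y1) ^ 2).
    - transitivity (A ^ 2 * (x1 * y2 - x2 * y1) ^ 2
        + A * ((quad A B C x1 y1 - y1) * y2 * (y1 - y2)
               + (quad A B C x2 y2 - y2) * y1 * (y2 - y1)));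
        [unfold quad; ring | rewrite H1, H2; ring].
    - rewrite Hang.
      transitivity (s2 * ((ell A B C x1 y1 * y1) * (ell A B C x2 y2 * y2)));
        [rewrite Hl1, Hl2; ring | ring]. }
  assert (Hell : ell A B C x y = (1 - t) * ell A B C x1 y1 + t * ell A B C x2 y2)
    by (unfold ell, x, y; ring).
  assert (HQ : quad A B C x y - y
               = - (t * (1 - t)) * quad A B C (x2 - x1) (y2 - y1)).
  { transitivity ((1 - t) * (quad A B C x1 y1 - y1) + t * (quad A B C x2 y2 - y2)
                  - t * (1 - t) * quad A B C (x2 - x1) (y2 - y1));
      [unfold quad, x, y; ring | rewrite H1, H2; ring]. }
  rewrite Hell, HQ.
  transitivity (s2 * ((1 - t) * ell A B C x1 y1 + t * ell A B C x2 y2) ^ 2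
    - 4 * t * (1 - t) * (A * quad A B C (x2 - x1) (y2 - y1))); [ring |].
  rewrite Hkey; ring.
Qed.

(** The equation is negative at [(0, 1 / (A + C))] exactly because [s2 < 1], and its quadratic part
    is 4 [A] times [quad] plus a nonnegative square. *)
Lemma envelope_is_ellipse (M : plane) (p q A B C s2 : R) :
  p ^ 2 + q ^ 2 = 1 -> 0 < A -> B ^ 2 < A * C -> 0 < s2 < 1 ->
  is_ellipse (fun P =>
    let x := xcoord M p q P in let y := ycoord M p q P in
    s2 * ell A B C x y ^ 2 + 4 * A * (quad A B C x y - y) = 0).
Proof.
  intros Hpq HA Hdisc Hs.
  assert (HC : 0 < C) by nra.
  pose proof (conic_is_ellipse M p q
    (4 * s2 * B ^ 2 + 4 * A ^ 2) (4 * A * B - 2 * s2 * B * (A - C))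
    (s2 * (A - C) ^ 2 + 4 * A * C) (- 2 * s2 * B) (s2 * (A - C) - 2 * A) s2
    0 (/ (A + C)) Hpq) as H.
  lapply H; [clear H; intros H | nra].
  lapply H; [clear H; intros H |].
  2:{ apply Rlt_0_minus.
    (* Adding [s2] times the square of a linear form changes the determinant by the adjugate form
       evaluated at its coefficients [(- 2 * B, A - C)]. *)
    replace (_ - _) with (16 * A ^ 2 * (A * C - B ^ 2)
      + 4 * A * s2 * quad C (- B) A (- 2 * B) (A - C)) by (unfold quad; ring).
    assert (0 <= quad C (- B) A (- 2 * B) (A - C)) by (apply quad_nonneg; nra).
    apply Rplus_lt_le_0_compat; [apply Rmult_lt_0_compat; nra |].
    apply Rmult_le_pos; nra. }
  lapply H; [clear H; intros H |].
  2:{ match goal with |- ?l < 0 =>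
        replace l with (- ((1 - s2) * (2 * A / (A + C)) ^ 2)) by (field; lra) end.
    apply Ropp_lt_gt_0_contravar, Rmult_lt_0_compat; [lra |].
    apply pow_lt, Rdiv_lt_0_compat; lra. }
  apply is_ellipse_coord; apply is_ellipse_coord in H.
  destruct H as (c & p' & q' & a & b & Hpq' & Ha & Hb & H).
  exists c, p', q', a, b.
  split; [assumption | split; [assumption | split; [assumption |]]].
  intros P; split; intros HP.
  - apply H; cbv zeta in HP |- *; rewrite <- HP; unfold ell, quad; ring.
  - apply H in HP; cbv zeta in HP |- *; rewrite <- HP; unfold ell, quad; ring.
Qed.

(** The restriction to the chord's line is a positive multiple of the square of a nonconstant affine
    function of [t]. The right angle is included. *)
Lemma chord_contact (E : plane -> Prop) (M N L : plane) (theta p q A B C : R) :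
  p ^ 2 + q ^ 2 = 1 -> 0 < A -> B ^ 2 < A * C -> 0 < theta < PI ->
  (forall P, E P <->
    quad A B C (xcoord M p q P) (ycoord M p q P) = ycoord M p q P) ->
  is_chord_with_angle E M theta N L ->
  exists t0 : R, forall t : R,
    let P := plus N (scal t (minus L N)) in
    let x := xcoord M p q P in let y := ycoord M p q P in
    sin theta ^ 2 * ell A B C x y ^ 2 + 4 * A * (quad A B C x y - y) = 0
    <-> t = t0.
Proof.
  intros Hpq HA Hdisc Hth HE (EN & EL & NM & LM & _ & Hang).
  assert (Hne : forall P, P <> M ->
            ~ (xcoord M p q P = 0 /\ ycoord M p q P = 0)).
  { intros P HP [Hx Hy]; destruct (coord_origin M p q) as [Hx0 Hy0].
    apply HP, (coord_inj M p q); congruence. }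
  assert (Hsq := cos_angle_sqr N M L NM LM).
  rewrite Hang, !(dot_coord M p q) in Hsq by assumption.
  apply HE in EN; apply HE in EL; apply Hne in NM; apply Hne in LM.
  set (x1 := xcoord M p q N) in *; set (y1 := ycoord M p q N) in *.
  set (x2 := xcoord M p q L) in *; set (y2 := ycoord M p q L) in *.
  destruct (conic_point_pos A B C x1 y1 HA Hdisc EN NM) as (_ & _ & Hl1).
  destruct (conic_point_pos A B C x2 y2 HA Hdisc EL LM) as (_ & _ & Hl2).
  (* Lagrange's identity turns the cosine relation into one for the determinant. *)
  assert (Hsin : (x1 * y2 - x2 * y1) ^ 2
                 = sin theta ^ 2 * ((x1 ^ 2 + y1 ^ 2) * (x2 ^ 2 + y2 ^ 2))).
  { assert (Hcs : sin theta ^ 2 = 1 - cos theta ^ 2)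
      by (rewrite <- !Rsqr_pow2; apply sin2).
    rewrite Hcs; nra. }
  assert (Hs : 0 < sin theta ^ 2) by (apply pow_lt, sin_gt_0; apply Hth).
  set (l1 := ell A B C x1 y1) in *; set (l2 := ell A B C x2 y2) in *.
  exists (l1 / (l1 + l2)); intros t P x y.
  assert (Hx : x = (1 - t) * x1 + t * x2) by apply xcoord_segment.
  assert (Hy : y = (1 - t) * y1 + t * y2) by apply ycoord_segment.
  rewrite Hx, Hy.
  rewrite (envelope_on_chord A B C (sin theta ^ 2) x1 y1 x2 y2 t) by assumption.
  fold l1 l2; split.
  - intros H.
    apply Rmult_integral in H; destruct H as [H | H]; [lra |].
    rewrite <- Rsqr_pow2 in H; apply Rsqr_0_uniq in H.
    apply (Rmult_eq_reg_r (l1 + l2)); [| lra].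
    transitivity l1; [lra | field; lra].
  - intros ->; field; lra.
Qed.

(** * Tangency of the chords to [E'], and their concurrence for a right angle *)

Theorem proposition1 : forall (E : plane -> Prop) (M : plane) (theta : R),
  is_ellipse E -> E M -> 0 < theta < PI ->
  (theta <> PI / 2 ->
     exists E' : plane -> Prop, is_ellipse E' /\
       forall N L : plane, is_chord_with_angle E M theta N L ->
         tangent E' (line N L)) /\
  (theta = PI / 2 ->
     exists F : plane,
       forall N L : plane, is_chord_with_angle E M theta N L ->
         line N L F).
Proof.
  intros E M theta HE HM Hth.
  destruct (tangent_frame E M HE HM) as (p & q & A & B & C & Hpq & HA & Hdisc & HEP).
  split.
  - intros Hne.
    assert (Hs : 0 < sin theta ^ 2 < 1).
    { split; [apply pow_lt, sin_gt_0; apply Hth |].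
      assert (Hc : cos theta <> 0).
      { intros H; apply Hne, cos_inj; rewrite ?cos_PI2; lra. }
      assert (Hcs := sin2_cos2 theta); unfold Rsqr in Hcs.
      apply Rsqr_pos_lt in Hc; unfold Rsqr in Hc; lra. }
    pose proof (envelope_is_ellipse M p q A B C _ Hpq HA Hdisc Hs) as HE'.
    eexists; split; [exact HE' |].
    intros N L Hch.
    destruct (chord_contact E M N L theta p q A B C) as (t0 & Ht0); try assumption.
    destruct Hch as (_ & _ & _ & _ & HNL & _).
    (* The line is reparametrized from the contact point, so that the only root becomes 0. *)
    assert (Hshift : forall t, plus (plus N (scal t0 (minus L N))) (scal t (minus L N))
                               = plus N (scal (t0 + t) (minus L N))).
    { intros t; rewrite !plane_sub, !plane_scal, !plane_add; cbn [fst snd].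
      f_equal; ring. }
    apply (tangent_if_touching_once _ _ (plus N (scal t0 (minus L N))) (minus L N)).
    + exact HE'.
    + apply Ht0; reflexivity.
    + rewrite plane_sub; intros H.
      unfold zero in H; cbn in H; unfold prod_zero, zero in H; cbn in H.
      injection H as H1 H2; apply HNL.
      rewrite (surjective_pairing N), (surjective_pairing L); f_equal; lra.
    + intros P; split; intros [t ->].
      * exists (t - t0); rewrite Hshift; do 2 f_equal; ring.
      * exists (t0 + t); apply Hshift.
    + intros t H; rewrite Hshift in H; apply Ht0 in H; lra.
  - intros Hright.
    destruct (coord_surj M p q 0 (/ (A + C)) Hpq) as (F & HFx & HFy).
    exists F; intros N L Hch.
    destruct (chord_contact E M N L theta p q A B C) as (t0 & Ht0); try assumption.
    exists t0.
    assert (H : t0 = t0) by reflexivity; apply Ht0 in H; cbv zeta in H.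
    rewrite Hright, sin_PI2 in H.
    set (x := xcoord M p q _) in H; set (y := ycoord M p q _) in H.
    (* With [sin theta = 1] the equation is a sum of two squares, which forces the contact point to
       be [F]. *)
    assert (Hsos : ((A + C) * y + 2 * B * x - 1) ^ 2 + (2 * A * x) ^ 2 = 0)
      by (rewrite <- H; unfold ell, quad; ring).
    assert (HC : 0 < C) by nra.
    rewrite <- !Rsqr_pow2 in Hsos; apply Rplus_sqr_eq_0 in Hsos.
    destruct Hsos as [Hy0 Hx0].
    assert (Hx : x = 0) by (apply Rmult_integral in Hx0; lra).
    assert (Hy : y = / (A + C)).
    { rewrite Hx in Hy0.
      apply (Rmult_eq_reg_l (A + C)); [| lra]. rewrite Rinv_r; lra. }
    apply (coord_inj M p q); [assumption | rewrite HFx; symmetry; exact Hx |].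
    rewrite HFy; symmetry; exact Hy.
Qed.
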